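(* Let $n=2$, $\mu>0$, $\kappa>0$, $k\ge \frac13$ and $\widehat k\ge\frac18$. Then the function $W_{\rm eH}:\mathbb{R}^{2\times 2}\to\mathbb{R}\cup\{+\infty\}$ defined by $$W_{\rm eH}(F)=\begin{cases}\dfrac{\mu}{k}\,e^{k\,\|\mathrm{dev}_2\log U\|^2}+\dfrac{\kappa}{2\widehat k}\,e^{\widehat k\,(\log\det U)^2} & \text{if }\det F>0,\\[2mm] +\infty & \text{if }\det F\le 0,\end{cases}\qquad U=\sqrt{F^TF},$$ is polyconvex.
   Context: For $X\in\mathbb{R}^{n\times n}$, $\|X\|=\sqrt{\mathrm{tr}(XX^T)}$ is the Frobenius norm and $\mathrm{dev}_nX=X-\frac1n\mathrm{tr}(X)\,I$ is the deviatoric part, with $I$ the identity matrix. For $F$ with $\det F>0$, $U=\sqrt{F^TF}$ is the unique symmetric positive definite square root of $F^TF$ and $\log U$ is its principal (symmetric) matrix logarithm. A function $W:\mathbb{R}^{2\times2}\to\mathbb{R}\cup\{+\infty\}$ is polyconvex if there is a convex function $P:\mathbb{R}^{2\times2}\times\mathbb{R}\to\mathbb{R}\cup\{+\infty\}$ with $W(F)=P(F,\det F)$ for all $F$. *)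

(* Defs.v *)
From HB Require Import structures.
From mathcomp Require Import all_boot all_order all_algebra.
From mathcomp Require Import all_classical all_reals all_analysis.

Set Implicit Arguments.
Unset Strict Implicit.
Unset Printing Implicit Defensive.

Import Order.TTheory GRing.Theory Num.Theory.
Import numFieldNormedType.Exports.

Local Open Scope classical_set_scope.
Local Open Scope ring_scope.

Section MatrixFunctions.
Context {R : realType} {n : nat}.
Implicit Types X A U L F : 'M[R]_n.

Definition frobenius X : R := Num.sqrt (\tr (X *m X^T)).

Definition dev X : 'M[R]_n := X - (n%:R^-1 * \tr X)%:M.

Definition spd A : Prop :=
  A^T = A /\ forall v : 'cV[R]_n, v != 0 -> 0 < (v^T *m A *m v) 0 0.

(* The unique symmetric positive definite square root when A is symmetric
   positive definite; 0 if there is none. *)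
Definition sqrtm A : 'M[R]_n := xget 0 [set U | spd U /\ U *m U = A].

Definition expm A : 'M[R]_n :=
  limn (series (fun k => (k`!%:R)^-1 *: A ^+ k)).

(* On symmetric positive definite matrices, the principal logarithm is the
   unique symmetric matrix whose exponential is U. *)
Definition logm U : 'M[R]_n := xget 0 [set L | L^T = L /\ expm L = U].

Definition W_eH (mu kappa k khat : R) F : \bar R :=
  let U := sqrtm (F^T *m F) in
  if 0 < \det F then
    (mu / k * expR (k * frobenius (dev (logm U)) ^+ 2)
     + kappa / (2 * khat) * expR (khat * ln (\det U) ^+ 2))%:E
  else +oo%E.

End MatrixFunctions.

(* Convexity of an extended-real function; the convention 0 * +oo = 0 makes
   the endpoints t = 0 and t = 1 harmless. *)
Definition econvex {R : realType} {V : lmodType R} (f : V -> \bar R) : Prop :=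
  forall (x y : V) (t : R), 0 <= t <= 1 ->
    (f (t *: x + (1 - t) *: y)%R <= t%:E * f x + (1 - t)%R%:E * f y)%E.

(* Values in R U {+oo} are extended reals different from -oo; R^o is R seen as
   a vector space over itself. *)
Definition polyconvex {R : realType} (W : 'M[R]_2 -> \bar R) : Prop :=
  exists P : 'M[R]_2 * R^o -> \bar R,
    [/\ forall z, P z != -oo%E,
        econvex P
      & forall F, W F = P (F, \det F)].

(* Main.v *)
Require Import Defs.
From mathcomp Require Import all_boot all_order all_algebra.
From mathcomp Require Import all_classical all_reals all_analysis.
From mathcomp Require Import ring lra.

Import Order.TTheory GRing.Theory Num.Theory.
Import numFieldNormedType.Exports.

Local Open Scope ring_scope.

(* Let x >= y > 0 be the singular values of F. Then |dev log U|^2 =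
   ln^2 (x / y) / 2 and x / y = |F|_op^2 / det F. The function
   (F, d) |-> |F|_op^2 / d is convex on d > 0, being the perspective of a
   squared norm, and exp (c ln^2 s) is convex in s > 0 for c >= 1/8 and
   nondecreasing for s >= 1. Taking c = k / 2 for the isochoric part and c = khat for the
   volumetric part gives a convex function of (F, det F). *)

(** * Convexity of [exp (c ln^2 s)] in one positive variable *)

Lemma mean_value {R : realType} (f df : R -> R) :
    (forall x : R, is_derive x 1 f (df x)) ->
  forall x y : R, x <= y -> exists2 z, x <= z <= y & f y - f x = df z * (y - x).
Proof.
move=> fdf x y xy.
have cf : {within `[x, y], continuous f}%classic.
  by apply: derivable_within_continuous => z _; have [] := fdf z.
have [z] := MVT_segment xy (fun z _ => fdf z) cf.
by rewrite in_itv /= => xzy; exists z.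
Qed.

Lemma is_derive_quad {R : realType} (a b x : R) :
  is_derive x 1 (fun u : R => a * u ^+ 2 + b * u) (2 * a * x + b).
Proof.
have -> : (fun u : R => a * u ^+ 2 + b * u) = a \*: (@id R ^+ 2) + b \*: @id R.
  by apply/funext => u.
apply: is_derive_eq.
rewrite /GRing.scale /= expr1 mulr1 mulr1; ring.
Qed.

Lemma is_derive_expR_quad {R : realType} (a b x : R) :
  is_derive x 1 (fun u : R => expR (a * u ^+ 2 + b * u))
    ((2 * a * x + b) * expR (a * x ^+ 2 + b * x)).
Proof.
rewrite mulrC; apply: (@is_derive1_comp R expR _ x).
exact: is_derive_quad.
Qed.

(* [u * exp (c u^2 - u)] is, up to the factor [2 c], the derivative of
   [exp (c ln^2 t)] at [t = exp u]; the bound [1/8 <= c] makes the discriminant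
   of [2 c u^2 - u + 1] nonpositive. *)
Lemma nondecreasing_id_mul_expR {R : realType} (c : R) : 1 / 8 <= c ->
  {homo (fun u : R => u * expR (c * u ^+ 2 - u)) : u v / u <= v}.
Proof.
move=> c8 u v uv.
have fE : (fun u : R => u * expR (c * u ^+ 2 - u)) =
          @id R * (fun u : R => expR (c * u ^+ 2 + -1 * u)).
  by apply/funext => w; rewrite -[RHS]/(w * expR (c * w ^+ 2 + -1 * w)) mulN1r.
pose df w := (2 * c * w ^+ 2 - w + 1) * expR (c * w ^+ 2 + -1 * w).
have fdf (w : R) :
    is_derive w 1 (fun u : R => u * expR (c * u ^+ 2 - u)) (df w).
  rewrite fE.
  have dE := is_derive_expR_quad c (-1) w.
  apply: is_derive_eq; rewrite /GRing.scale /= /df; ring.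
have [z _ E] := mean_value _ df fdf u v uv.
rewrite -subr_ge0 E mulr_ge0 ?subr_ge0 // mulr_ge0 ?expR_ge0 //.
(* The quadratic factor equals [2 (c - 1/8) z^2 + (z/2 - 1)^2]. *)
have : 0 <= (c - 1 / 8) * z ^+ 2 by rewrite mulr_ge0 ?subr_ge0 // sqr_ge0.
have := sqr_ge0 (z / 2 - 1); nra.
Qed.

(** With [s = exp u], this puts [exp (c ln^2 s)] above its tangent at [exp v]. The gap has
    derivative [2 c exp u (m u - m v)] in [u], so it is least at [u = v] because [m] is
    nondecreasing. *)
Lemma expR_sqr_tangent {R : realType} (c u v : R) : 1 / 8 <= c ->
  expR (c * v ^+ 2) + 2 * c * v * expR (c * v ^+ 2 - v) * (expR u - expR v)
    <= expR (c * u ^+ 2).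
Proof.
move=> c8; set m := fun u : R => u * expR (c * u ^+ 2 - u).
have mono := @nondecreasing_id_mul_expR R c c8.
(* The null terms bring both exponentials to the form of [is_derive_expR_quad]. *)
pose f w := expR (c * w ^+ 2 + 0 * w) - 2 * c * m v * expR (0 * w ^+ 2 + 1 * w).
pose df w := 2 * c * expR w * (m w - m v).
have fdf (w : R) : is_derive w 1 f (df w).
  have -> : f = (fun w => expR (c * w ^+ 2 + 0 * w)) -
     (2 * c * m v) \*: (fun w => expR (0 * w ^+ 2 + 1 * w)) by apply/funext.
  have d1 := is_derive_expR_quad c 0 w; have d2 := is_derive_expR_quad 0 1 w.
  apply: is_derive_eq; rewrite /GRing.scale /= /df.
  rewrite !(mul0r, mulr0, mul1r, addr0, add0r) {2}/m expRB.
  by field; rewrite expR_eq0.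
have c0 : 0 <= c by lra.
suff : f v <= f u.
  rewrite /f /m !(mul0r, mulr0, mul1r, addr0, add0r) => ?; nra.
rewrite -subr_ge0; have [uv|/ltW vu] := lerP v u.
  have [z /andP[vz zu] ->] := @mean_value R f df fdf v u uv.
  rewrite mulr_ge0 ?subr_ge0 // !mulr_ge0 ?expR_ge0 ?subr_ge0 //; exact: mono.
have [z /andP[uz zv] E] := @mean_value R f df fdf u v vu.
rewrite -opprB E -mulrN mulr_le0 //; last by rewrite oppr_le0 subr_ge0.
by rewrite mulr_ge0_le0 ?mulr_ge0 ?expR_ge0 ?subr_le0 //; exact: mono.
Qed.

(** Averages two tangent inequalities based at the convex combination [z]; the slope terms
    cancel. *)
Lemma expR_ln_sqr_convex {R : realType} (c : R) : 1 / 8 <= c ->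
  forall x y t : R, 0 < x -> 0 < y -> 0 <= t <= 1 ->
  expR (c * ln (t * x + (1 - t) * y) ^+ 2)
    <= t * expR (c * ln x ^+ 2) + (1 - t) * expR (c * ln y ^+ 2).
Proof.
move=> c8 x y t x0 y0 /andP[t0 t1].
set z := t * x + (1 - t) * y.
have z0 : 0 < z by rewrite /z; nra.
have := expR_sqr_tangent c (ln x) (ln z) c8.
have := expR_sqr_tangent c (ln y) (ln z) c8.
rewrite !lnK ?posrE //; set K := _ * expR (_ - _); set Z := expR _.
set X := expR (c * ln x ^+ 2); set Y := expR (c * ln y ^+ 2) => Yz Xz.
have zE : t * (x - z) + (1 - t) * (y - z) = 0 by rewrite /z; ring.
have -> : Z = t * (Z + K * (x - z)) + (1 - t) * (Z + K * (y - z)).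
  by rewrite -[LHS]addr0 -(mulr0 K) -zE; ring.
by rewrite lerD // ler_wpM2l // subr_ge0.
Qed.

(** * Operator norm and joint convexity of the distortion *)

Definition norm2 {R : realType} (x y : R) : R := Num.sqrt (x ^+ 2 + y ^+ 2).

Lemma norm2_ge0 {R : realType} (x y : R) : 0 <= norm2 x y.
Proof. exact: sqrtr_ge0. Qed.

Lemma sqr_norm2 {R : realType} (x y : R) : norm2 x y ^+ 2 = x ^+ 2 + y ^+ 2.
Proof. by rewrite sqr_sqrtr // addr_ge0 ?sqr_ge0. Qed.

(** Reduces to Cauchy-Schwarz, which follows from Lagrange's identity with remainder
    [(x w - y z)^2]. *)
Lemma norm2D {R : realType} (x y z w : R) :
  norm2 (x + z) (y + w) <= norm2 x y + norm2 z w.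
Proof.
rewrite -(@ler_pXn2r _ 2) ?nnegrE ?addr_ge0 ?norm2_ge0 //.
rewrite sqr_norm2 [leRHS]sqrrD !sqr_norm2.
suff : x * z + y * w <= norm2 x y * norm2 z w by nra.
rewrite (le_trans (ler_norm _)) //.
rewrite -(@ler_pXn2r _ 2) ?nnegrE ?mulr_ge0 ?norm2_ge0 //.
rewrite real_normK ?num_real // exprMn !sqr_norm2 -subr_ge0.
by rewrite [leRHS](_ : _ = (x * w - y * z) ^+ 2) ?sqr_ge0 //; ring.
Qed.

Lemma norm2Z {R : realType} (a x y : R) : 0 <= a ->
  norm2 (a * x) (a * y) = a * norm2 x y.
Proof.
move=> a0; rewrite /norm2 !exprMn -mulrDr sqrtrM ?sqr_ge0 //.
by rewrite sqrtr_sqr ger0_norm.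
Qed.

(* A real 2x2 matrix is, as a map of the complex plane, z |-> p z + q conj z;
   its largest singular value is |p| + |q| and its determinant
   |p|^2 - |q|^2. *)
Definition opnorm2 {R : realType} (F : 'M[R]_2) : R :=
  (norm2 (F 0 0 + F 1 1) (F 1 0 - F 0 1)
   + norm2 (F 0 0 - F 1 1) (F 1 0 + F 0 1)) / 2.

Lemma opnorm2_ge0 {R : realType} (F : 'M[R]_2) : 0 <= opnorm2 F.
Proof. by rewrite divr_ge0 ?addr_ge0 ?norm2_ge0. Qed.

(** Both summands of [opnorm2] are Euclidean norms of linear functions of the matrix. *)
Lemma opnorm2_convex {R : realType} (F G : 'M[R]_2) (t : R) : 0 <= t <= 1 ->
  opnorm2 (t *: F + (1 - t) *: G) <= t * opnorm2 F + (1 - t) * opnorm2 G.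
Proof.
move=> /andP[t0 t1]; have t'0 : 0 <= 1 - t by rewrite subr_ge0.
rewrite /opnorm2 !mxE.
set n1 := norm2 _ _; set n2 := norm2 _ _.
have l1 : n1 <= t * norm2 (F 0 0 + F 1 1) (F 1 0 - F 0 1)
          + (1 - t) * norm2 (G 0 0 + G 1 1) (G 1 0 - G 0 1).
  rewrite -!norm2Z // (le_trans _ (norm2D _ _ _ _)) //.
  by rewrite /n1 le_eqVlt; apply/orP; left; apply/eqP; congr norm2; ring.
have l2 : n2 <= t * norm2 (F 0 0 - F 1 1) (F 1 0 + F 0 1)
          + (1 - t) * norm2 (G 0 0 - G 1 1) (G 1 0 + G 0 1).
  rewrite -!norm2Z // (le_trans _ (norm2D _ _ _ _)) //.
  by rewrite /n2 le_eqVlt; apply/orP; left; apply/eqP; congr norm2; ring.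
lra.
Qed.

(** Once the left denominator is cleared, the gap is [t (1 - t) (a d - b c)^2 / (c d)]. *)
Lemma perspective_sqr_le {R : realType} (a b c d t : R) :
  0 < c -> 0 < d -> 0 <= t <= 1 ->
  (t * a + (1 - t) * b) ^+ 2 / (t * c + (1 - t) * d)
    <= t * (a ^+ 2 / c) + (1 - t) * (b ^+ 2 / d).
Proof.
move=> c0 d0 /andP[t0 t1].
have e0 : 0 < t * c + (1 - t) * d by nra.
rewrite ler_pdivrMr // -subr_ge0.
rewrite [leRHS](_ : _ = t * (1 - t) * (a * d - b * c) ^+ 2 / (c * d)).
  have cd0 := mulr_gt0 c0 d0.
  by rewrite divr_ge0 ?(ltW cd0) // mulr_ge0 ?sqr_ge0 // mulr_ge0 // subr_ge0.
by field; rewrite !gt_eqF.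
Qed.

(* For [d = det F > 0] this is the ratio of the singular values of [F]; the
   cut-off at [1] keeps it, for every pair [(F, d)], where [exp (a ln^2 s)] is
   nondecreasing. *)
Definition distortion {R : realType} (F : 'M[R]_2) (d : R) : R :=
  Num.max 1 (opnorm2 F ^+ 2 / d).

Lemma distortion_convex {R : realType} (F G : 'M[R]_2) (c d t : R) :
  0 < c -> 0 < d -> 0 <= t <= 1 ->
  distortion (t *: F + (1 - t) *: G) (t * c + (1 - t) * d)
    <= t * distortion F c + (1 - t) * distortion G d.
Proof.
move=> c0 d0 /[dup] tI /andP[t0 t1].
have max1 (s : R) : 1 <= Num.max 1 s /\ s <= Num.max 1 s.
  by rewrite !le_max !lexx orbT.
have [F1 Fd] := max1 (opnorm2 F ^+ 2 / c).
have [G1 Gd] := max1 (opnorm2 G ^+ 2 / d).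
rewrite /distortion ge_max; apply/andP; split; first by nra.
have e0 : 0 < t * c + (1 - t) * d by nra.
apply: le_trans
    (_ : t * (opnorm2 F ^+ 2 / c) + (1 - t) * (opnorm2 G ^+ 2 / d) <= _).
  apply: le_trans (perspective_sqr_le _ _ _ _ _ c0 d0 tI).
  rewrite ler_pM2r ?invr_gt0 // ler_pXn2r ?nnegrE ?opnorm2_ge0 //.
    exact: opnorm2_convex.
  by rewrite addr_ge0 // mulr_ge0 ?opnorm2_ge0 ?subr_ge0.
by rewrite lerD // ler_wpM2l // subr_ge0.
Qed.

(** The cut-off makes both logarithms nonnegative, so squaring keeps their order and
    [expR_ln_sqr_convex] applies. *)
Lemma expR_ln_sqr_distortion_convex {R : realType}
    (F G : 'M[R]_2) (a c d t : R) :
  1 / 8 <= a -> 0 < c -> 0 < d -> 0 <= t <= 1 ->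
  expR (a * ln (distortion (t *: F + (1 - t) *: G) (t * c + (1 - t) * d)) ^+ 2)
    <= t * expR (a * ln (distortion F c) ^+ 2)
       + (1 - t) * expR (a * ln (distortion G d) ^+ 2).
Proof.
move=> a8 c0 d0 tI.
have ge1 (H : 'M[R]_2) (e : R) : 1 <= distortion H e.
  by rewrite /distortion le_max lexx.
have gt0 (H : 'M[R]_2) (e : R) : 0 < distortion H e :=
  lt_le_trans ltr01 (ge1 H e).
apply: le_trans (expR_ln_sqr_convex a a8 _ _ t (gt0 F c) (gt0 G d) tI).
have le := distortion_convex F G c d t c0 d0 tI.
have ln0 : 0 <= ln (distortion (t *: F + (1 - t) *: G) (t * c + (1 - t) * d)).
  exact: ln_ge0.
have a0 : 0 <= a by lra.
have ln_le : ln (distortion (t *: F + (1 - t) *: G) (t * c + (1 - t) * d))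
   <= ln (t * distortion F c + (1 - t) * distortion G d).
  by rewrite ler_ln ?posrE ?gt0 // (lt_le_trans (gt0 _ _) le).
rewrite ler_expR ler_wpM2l // ler_pXn2r ?nnegrE //; exact: le_trans ln_le.
Qed.

(** The witness for polyconvexity: [z.2] varies independently of [z.1]. *)
Definition hencky_potential {R : realType} (mu kappa k khat : R)
    (z : 'M[R]_2 * R^o) : \bar R :=
  if 0 < z.2 then
    (mu / k * expR (k / 2 * ln (distortion z.1 z.2) ^+ 2)
     + kappa / (2 * khat) * expR (khat * ln z.2 ^+ 2))%:E
  else +oo%E.

Lemma hencky_potential_convex {R : realType} (mu kappa k khat : R) :
  0 < mu -> 0 < kappa -> 1 / 4 <= k -> 1 / 8 <= khat ->
  econvex (hencky_potential mu kappa k khat).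
Proof.
move=> mu0 kappa0 k4 kh8 [F c] [G d] t /[dup] tI /andP[].
set P := hencky_potential _ _ _ _.
have PN z : P z != -oo%E by rewrite /P /hencky_potential; case: ifP.
(* The endpoints go first: there a zero weight cancels a possible [+oo], whereas for [0 < t < 1] an
   infinite value makes the right side [+oo]. *)
rewrite le_eqVlt => /predU1P[<- _|t0].
  by rewrite scale0r add0r subr0 scale1r mul0e add0e mul1e.
rewrite le_eqVlt => /predU1P[->|t1].
  by rewrite subrr scale0r addr0 scale1r mul0e adde0 mul1e.
have [c0|c0] := ltP 0 c; last first.
  rewrite {2}/P /hencky_potential /= ltNge c0 /= gt0_muley ?lte_fin //.
  by rewrite addye ?leey //; case: (P _) (PN (G, d)) => [r||] //;
    rewrite gt0_muley ?lte_fin ?subr_gt0.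
have [d0|d0] := ltP 0 d; last first.
  rewrite {3}/P /hencky_potential /= ltNge d0 /= gt0_muley ?lte_fin ?subr_gt0 //.
  by rewrite addey ?leey //; case: (P _) (PN (F, c)) => [r||] //;
    rewrite gt0_muley ?lte_fin.
rewrite /P /hencky_potential /= c0 d0.
have -> : 0 < t *: c + (1 - t) *: d by rewrite /GRing.scale /=; nra.
rewrite -!EFinM -EFinD lee_fin.
have muk : 0 <= mu / k by rewrite divr_ge0 ?ltW //; lra.
have kk : 0 <= kappa / (2 * khat) by rewrite divr_ge0 ?ltW //; lra.
have k8 : 1 / 8 <= k / 2 by lra.
have := ler_wpM2l muk (expR_ln_sqr_distortion_convex F G _ c d t k8 c0 d0 tI).
have := ler_wpM2l kk (expR_ln_sqr_convex _ kh8 c d t c0 d0 tI).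
rewrite /GRing.scale /= => A B; apply: le_trans (lerD B A) _.
by rewrite le_eqVlt; apply/orP; left; apply/eqP; ring.
Qed.

(** * Exponential of a matrix in spectral form *)

Lemma expm_cvg {R : realType} {n : nat} (A L : 'M[R]_n) :
  (series (fun k => (k`!%:R)^-1 *: A ^+ k) @ \oo --> L)%classic -> expm A = L.
Proof. by move=> cA; apply: cvg_lim cA. Qed.

(* [P] is a projection, so [a P + b (1 - P)] has eigenvalues [a] and [b]. *)
Definition spectral {R : realType} {n : nat} (P : 'M[R]_n) (a b : R) :
    'M[R]_n :=
  a *: P + b *: (1 - P).

Lemma spectralM {R : realType} {n : nat} (P : 'M[R]_n) (a b c d : R) :
  P *m P = P -> spectral P a b *m spectral P c d = spectral P (a * c) (b * d).
Proof.
move=> PP; have PQ : P *m (1 - P) = 0 by rewrite mulmxBr mulmx1 PP subrr.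
have QP : (1 - P) *m P = 0 by rewrite mulmxBl mul1mx PP subrr.
have QQ : (1 - P) *m (1 - P) = 1 - P by rewrite mulmxBl mul1mx PQ subr0.
rewrite /spectral mulmxDl !mulmxDr -!scalemxAl -!scalemxAr PP PQ QP QQ.
by rewrite !scaler0 addr0 add0r !scalerA.
Qed.

Lemma spectralX {R : realType} {n : nat} (P : 'M[R]_n) (a b : R) (m : nat) :
  P *m P = P -> spectral P a b ^+ m = spectral P (a ^+ m) (b ^+ m).
Proof.
move=> PP; elim: m => [|m IH].
  by rewrite !expr0 /spectral !scale1r addrC subrK.
by rewrite exprS IH [LHS]spectralM // !exprS.
Qed.

(** Powers act on the two coefficients separately, so the matrix series splits into two scalar
    ones. *)
Lemma expm_spectral {R : realType} {n : nat} (P : 'M[R]_n) (a b : R) :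
  P *m P = P -> expm (spectral P a b) = spectral P (expR a) (expR b).
Proof.
move=> PP; apply: expm_cvg.
have -> : series (fun k => (k`!%:R)^-1 *: spectral P a b ^+ k) =
    (fun m => series (exp_coeff a) m *: P + series (exp_coeff b) m *: (1 - P)).
  apply/funext => m; rewrite /series /= !scaler_suml -big_split /=.
  apply: eq_bigr => k _; rewrite spectralX // /spectral scalerDr !scalerA.
  by rewrite /exp_coeff /= ![_^-1 * _]mulrC.
apply: cvgD; apply: cvgZ; by [exact: is_cvg_series_exp_coeff | exact: cvg_cst].
Qed.

Lemma tr_spectral {R : realType} {n : nat} (P : 'M[R]_n) (a b : R) :
  P^T = P -> (spectral P a b)^T = spectral P a b.
Proof.
by move=> PT; rewrite /spectral linearD /= !linearZ /= linearB /= trmx1 PT.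
Qed.

Lemma mxtrace_spectral {R : realType} {n : nat} (P : 'M[R]_n) (a b : R) :
  \tr (spectral P a b) = a * \tr P + b * (n%:R - \tr P).
Proof. by rewrite /spectral linearD /= !linearZ /= linearB /= mxtrace1. Qed.

(** * Two by two matrices and their diagonalisation *)

Lemma matrix2P {R : Type} (A B : 'M[R]_2) :
  A 0 0 = B 0 0 -> A 0 1 = B 0 1 -> A 1 0 = B 1 0 -> A 1 1 = B 1 1 -> A = B.
Proof.
move=> e00 e01 e10 e11; apply/matrixP => i j.
have [->|->] : i = 0 \/ i = 1.
  by case: i => -[|[|//]] ?; [left|right]; exact: val_inj.
all: have [->|->] // : j = 0 \/ j = 1.
all: by case: j => -[|[|//]] ?; [left|right]; exact: val_inj.
Qed.

Lemma sum2E {V : nmodType} (f : 'I_2 -> V) : \sum_i f i = f 0 + f 1.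
Proof. by rewrite big_ord_recl big_ord1; congr (_ + f _); exact: val_inj. Qed.

Lemma mulmx2E {R : realType} (A B : 'M[R]_2) i j :
  (A *m B) i j = A i 0 * B 0 j + A i 1 * B 1 j.
Proof. by rewrite mxE sum2E. Qed.

Lemma mxtrace2E {R : realType} (A : 'M[R]_2) : \tr A = A 0 0 + A 1 1.
Proof. by rewrite /mxtrace sum2E. Qed.

Lemma det2E {R : realType} (A : 'M[R]_2) :
  \det A = A 0 0 * A 1 1 - A 0 1 * A 1 0.
Proof.
rewrite (expand_det_row _ 0) sum2E /cofactor !det_mx11 !mxE.
have -> : lift 0 0 = 1 :> 'I_2 by exact: val_inj.
have -> : lift 1 0 = 0 :> 'I_2 by exact: val_inj.
by rewrite /= expr0 expr1; ring.
Qed.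

(** Gives access to the determinant of a spectral form through [mxtrace_spectral]. *)
Lemma det2_trace {R : realType} (A : 'M[R]_2) :
  \det A = ((\tr A) ^+ 2 - \tr (A *m A)) / 2.
Proof. by rewrite det2E !mxtrace2E !mulmx2E; field. Qed.

Lemma symmetric2_spectral {R : realType} (A : 'M[R]_2) : A^T = A ->
  exists P a b, [/\ P^T = P, P *m P = P, \tr P = 1 & A = spectral P a b].
Proof.
move=> AT; have A10 : A 1 0 = A 0 1 by rewrite -[in LHS]AT mxE.
set r := Num.sqrt ((A 0 0 - A 1 1) ^+ 2 + 4 * A 0 1 ^+ 2).
have r2 : r ^+ 2 = (A 0 0 - A 1 1) ^+ 2 + 4 * A 0 1 ^+ 2.
  by rewrite sqr_sqrtr // addr_ge0 ?sqr_ge0 // mulr_ge0 ?sqr_ge0.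
clearbody r.
have [r0|r0] := eqVneq r 0.
  (* A double eigenvalue makes [A] scalar, so any rank-one orthogonal projection serves. *)
  exists (delta_mx 0 0), (A 0 0), (A 0 0); split.
  - by rewrite trmx_delta.
  - by rewrite mul_delta_mx.
  - by rewrite mxtrace2E !mxE /= addr0.
  - rewrite /spectral -scalerDr addrC subrK.
    move: r2; rewrite r0 expr0n /= => /esym r2.
    have d0 : A 0 0 - A 1 1 = 0 by nra.
    have b0 : A 0 1 = 0 by nra.
    apply: matrix2P; rewrite !mxE /= ?A10 ?b0 ?mulr0 ?mulr1 //.
    by move/eqP: d0; rewrite subr_eq0 => /eqP.
(* [r] is the gap between the eigenvalues [a] and [b], and [P] is the Lagrange projection
   [(A - b I) / (a - b)]. *)
pose P := (2 * r)^-1 *: (2 *: A - (A 0 0 + A 1 1 - r)%:M).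
(* The [(0, 0)] entry of [P *m P - P], in the form left by [mxE]; it vanishes by [r2]. *)
have diagE : (2 * r)^-1 * (2 * A 0 0 - (A 0 0 + A 1 1 - r) *+ 1) *
  ((2 * r)^-1 * (2 * A 0 0 - (A 0 0 + A 1 1 - r) *+ 1)) +
  (2 * r)^-1 * (2 * A 0 1 - (A 0 0 + A 1 1 - r) *+ 0) *
  ((2 * r)^-1 * (2 * A 0 1 - (A 0 0 + A 1 1 - r) *+ 0)) -
  (2 * r)^-1 * (2 * A 0 0 - (A 0 0 + A 1 1 - r) *+ 1) = 0.
  rewrite -[RHS](mul0r (4 * r ^+ 2)^-1) -(subrr (r ^+ 2)) {1}r2.
  by field.
exists P, ((A 0 0 + A 1 1 + r) / 2), ((A 0 0 + A 1 1 - r) / 2); split.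
- by rewrite /P linearZ /= linearB /= linearZ /= tr_scalar_mx AT.
- apply: matrix2P; rewrite mulmx2E !mxE /= ?A10; apply: subr0_eq.
  + exact: diagE.
  + by field.
  + by field.
  + by rewrite -[RHS]diagE; field.
- by rewrite mxtrace2E !mxE /=; field.
- apply: matrix2P; rewrite !mxE /= ?A10; by field.
Qed.

(** * Existence of the square root and of the logarithm *)

Lemma spd2_diag_det_gt0 {R : realType} (U : 'M[R]_2) : spd U ->
  [/\ 0 < U 0 0, 0 < U 1 1 & 0 < \det U].
Proof.
move=> [UT Upos]; have U10 : U 1 0 = U 0 1 by rewrite -[in LHS]UT mxE.
have form (x y : R) : (x != 0) || (y != 0) ->
    0 < U 0 0 * x ^+ 2 + 2 * U 0 1 * x * y + U 1 1 * y ^+ 2.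
  move=> xy0; pose v : 'cV[R]_2 := \col_i (if i == 0 then x else y).
  have v0 : v != 0.
    apply: contraTneq xy0 => v0; rewrite negb_or !negbK.
    have := congr1 (fun M : 'cV[R]_2 => (M 0 0, M 1 0)) v0.
    by rewrite !mxE /= => -[-> ->]; rewrite eqxx.
  have := Upos v v0.
  rewrite mxE sum2E !mxE !sum2E !mxE /= U10; congr (0 < _); ring.
have U00 : 0 < U 0 0.
  have := form 1 0; rewrite oner_neq0 => /(_ isT).
  by congr (0 < _); ring.
split=> //.
  have := form 0 1; rewrite oner_neq0 orbT => /(_ isT).
  by congr (0 < _); ring.
(* At this vector the quadratic form equals [U 0 0 * \det U]. *)
have := form (- U 0 1) (U 0 0); rewrite (gt_eqF U00) orbT => /(_ isT).
have -> : U 0 0 * (- U 0 1) ^+ 2 + 2 * U 0 1 * (- U 0 1) * U 0 0 +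
    U 1 1 * U 0 0 ^+ 2 = U 0 0 * \det U by rewrite det2E U10; ring.
by rewrite pmulr_rgt0.
Qed.

Lemma trmxM_tr_ge0 {R : realType} {m n : nat}
    (F : 'M[R]_(m, n)) (v : 'cV[R]_n) :
  0 <= (v^T *m (F^T *m F) *m v) 0 0.
Proof.
have -> : v^T *m (F^T *m F) *m v = (F *m v)^T *m (F *m v).
  by rewrite trmx_mul !mulmxA.
by rewrite mxE sumr_ge0 // => i _; rewrite mxE -expr2 sqr_ge0.
Qed.

(* By Cayley-Hamilton, with [d = det F] and [A = F^T F], the square root of [A]
   is [(A + d I) / sqrt (tr A + 2 d)]. *)
Lemma sqrtm_gram {R : realType} (F : 'M[R]_2) : 0 < \det F ->
  let U := sqrtm (F^T *m F) in spd U /\ U *m U = F^T *m F.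
Proof.
move=> d0; set A := F^T *m F; set d := \det F in d0.
(* Exhibiting one root keeps [sqrtm] away from its default value [0]. *)
apply: (@xgetPex _ 0 [set U | spd U /\ U *m U = A]%classic).
have trA : \tr A = F 0 0 ^+ 2 + F 0 1 ^+ 2 + F 1 0 ^+ 2 + F 1 1 ^+ 2.
  by rewrite mxtrace2E !mulmx2E !mxE; ring.
have trA0 : 0 <= \tr A by rewrite trA !addr_ge0 ?sqr_ge0.
pose s := Num.sqrt (\tr A + 2 * d).
have s0 : 0 < s by rewrite sqrtr_gt0; lra.
have s2 : s ^+ 2 = \tr A + 2 * d by rewrite sqr_sqrtr //; lra.
exists (s^-1 *: (A + d%:M)); split; last first.
  rewrite -scalemxAl -scalemxAr scalerA -invfM -expr2 s2.
  have q0 : \tr A + 2 * d != 0 by rewrite gt_eqF //; lra.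
  apply: (scalerI q0); rewrite scalerA divff // scale1r.
  rewrite trA /d det2E.
  by apply: matrix2P; rewrite !(mulmx2E, mxE) /=; ring.
split=> [|v v0].
  by rewrite linearZ /= linearD /= tr_scalar_mx trmx_mul trmxK.
rewrite -scalemxAr -scalemxAl mxE mulr_gt0 ?invr_gt0 // mulmxDr mulmxDl mxE.
rewrite ltr_wpDl ?trmxM_tr_ge0 // mul_mx_scalar -scalemxAl mxE mulr_gt0 //.
rewrite lt_neqAle; apply/andP; split; last first.
  by rewrite mxE sumr_ge0 // => i _; rewrite mxE -expr2 sqr_ge0.
apply: contra_neq v0 => /esym; rewrite mxE => /eqP.
rewrite psumr_eq0 => [/allP v0|i _]; last by rewrite mxE -expr2 sqr_ge0.
apply/matrixP => i j; rewrite ord1 mxE.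
have := v0 i; rewrite mem_index_enum mxE -expr2 sqrf_eq0 => /(_ isT).
by move/eqP.
Qed.

Lemma logm_spd2 {R : realType} (U : 'M[R]_2) : spd U ->
  (logm U)^T = logm U /\ expm (logm U) = U.
Proof.
move=> Uspd; have [UT _] := Uspd.
apply: (@xgetPex _ 0 [set L | L^T = L /\ expm L = U]%classic).
have [P [a [b [PT PP trP UE]]]] := symmetric2_spectral U UT.
have [U0 U1 detU] := spd2_diag_det_gt0 U Uspd.
have trU : U 0 0 + U 1 1 = a + b.
  by rewrite -mxtrace2E UE mxtrace_spectral trP; ring.
have detE : \det U = a * b.
  by rewrite det2_trace UE spectralM // !mxtrace_spectral trP; field.
rewrite detE in detU.
(* If [a <= 0], the positive trace forces [0 <= b], against [0 < a * b]. *)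
have a0 : 0 < a.
  rewrite ltNge; apply/negP => a0.
  have b0 : 0 <= b by lra.
  by have := mulr_le0_ge0 a0 b0; lra.
have b0 : 0 < b by rewrite -(pmulr_rgt0 _ a0).
exists (spectral P (ln a) (ln b)); split; first exact: tr_spectral.
by rewrite expm_spectral // !lnK.
Qed.

(** * The energy in terms of principal stretches *)

(** Diagonalising [logm U] instead of [U] yields [a] and [b] directly as logarithms of the singular
    values. *)
Lemma log_principal_stretches {R : realType} (F : 'M[R]_2) : 0 < \det F ->
  let U := sqrtm (F^T *m F) in
  exists a b : R, [/\ frobenius (dev (logm U)) ^+ 2 = (a - b) ^+ 2 / 2,
    \det U = \det F, \det F = expR a * expR b
    & \tr (F^T *m F) = expR a ^+ 2 + expR b ^+ 2].
Proof.
move=> d0 U; have [Uspd UU] := sqrtm_gram F d0.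
rewrite -/U in Uspd UU.
have [LT expL] := logm_spd2 U Uspd.
have [_ _ detU] := spd2_diag_det_gt0 U Uspd.
have [P [a [b [PT PP trP LE]]]] := symmetric2_spectral _ LT.
have UE : U = spectral P (expR a) (expR b) by rewrite -expL LE expm_spectral.
have detUF : \det U = \det F.
  apply/eqP; rewrite -(@eqrXn2 _ 2) ?ltW // !expr2 -det_mulmx UU.
  by rewrite det_mulmx det_tr.
exists a, b; split => //.
(* Since [\tr P = 1], the mean eigenvalue [(a + b) / 2] is subtracted. *)
- have devE : dev (logm U) = spectral P ((a - b) / 2) ((b - a) / 2).
    rewrite /dev {2}LE mxtrace_spectral trP LE.
    by apply: matrix2P; rewrite !mxE /=; field.
  rewrite /frobenius devE tr_spectral // spectralM // mxtrace_spectral trP.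
  rewrite sqr_sqrtr; first by field.
  have := sqr_ge0 (a - b); nra.
- by rewrite -detUF det2_trace UE spectralM // !mxtrace_spectral trP; field.
- by rewrite -UU UE spectralM // mxtrace_spectral trP; ring.
Qed.

Lemma distortion_det {R : realType} (F : 'M[R]_2) (a b : R) :
  \det F = expR a * expR b -> \tr (F^T *m F) = expR a ^+ 2 + expR b ^+ 2 ->
  ln (distortion F (\det F)) ^+ 2 = (a - b) ^+ 2.
Proof.
(* The statement is symmetric in [a] and [b]; this order makes [exp (a - b)] at least [1], so the
   maximum is attained there. *)
wlog ba : a b / b <= a => [wl|detF trF].
  have [/wl //|/ltW ab detF trF] := lerP b a.
  rewrite mulrC in detF; rewrite addrC in trF.
  by rewrite (wl b a ab detF trF); ring.
have x0 := expR_gt0 a; have y0 := expR_gt0 b.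
have xy : expR b <= expR a by rewrite ler_expR.
have trE : \tr (F^T *m F) = F 0 0 ^+ 2 + F 0 1 ^+ 2 + F 1 0 ^+ 2 + F 1 1 ^+ 2.
  by rewrite mxtrace2E !mulmx2E !mxE; ring.
have normE : opnorm2 F = expR a.
  rewrite /opnorm2.
  (* The squares of the two norms are [\tr (F^T *m F)] plus or minus [2 * \det F], that is
     [(exp a + exp b)^2] and [(exp a - exp b)^2]. *)
  have -> : norm2 (F 0 0 + F 1 1) (F 1 0 - F 0 1) = expR a + expR b.
    apply/eqP; rewrite -(@eqrXn2 _ 2) ?norm2_ge0 ?addr_ge0 ?ltW //.
    rewrite sqr_norm2 [X in _ == X](_ : _ = \tr (F^T *m F) + 2 * \det F).
      by rewrite trE det2E; apply/eqP; ring.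
    by rewrite trF detF; ring.
  have -> : norm2 (F 0 0 - F 1 1) (F 1 0 + F 0 1) = expR a - expR b.
    apply/eqP; rewrite -(@eqrXn2 _ 2) ?norm2_ge0 ?subr_ge0 //.
    rewrite sqr_norm2 [X in _ == X](_ : _ = \tr (F^T *m F) - 2 * \det F).
      by rewrite trE det2E; apply/eqP; ring.
    by rewrite trF detF; ring.
  by field.
have -> : distortion F (\det F) = expR (a - b).
  rewrite /distortion normE detF.
  have -> : expR a ^+ 2 / (expR a * expR b) = expR (a - b).
    by rewrite expRB; field; rewrite !gt_eqF.
  apply: max_r; rewrite -expR0 ler_expR subr_ge0 //.
by rewrite expRK.
Qed.

Theorem theorem3p11 (R : realType) (mu kappa k khat : R)
    (hmu : 0 < mu) (hkappa : 0 < kappa)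
    (hk : 1 / 3 <= k) (hkhat : 1 / 8 <= khat) :
  polyconvex (W_eH mu kappa k khat).
Proof.
exists (hencky_potential mu kappa k khat); split.
- by move=> z; rewrite /hencky_potential; case: ifP.
- apply: hencky_potential_convex => //; lra.
- move=> F; rewrite /W_eH /hencky_potential /=; case: ifP => // d0.
  have [a [b [devE detU detF trF]]] := log_principal_stretches F d0.
  rewrite devE detU (distortion_det F a b) //.
  (* The factor [k / 2] of the potential absorbs the [1/2] in the squared deviatoric norm. *)
  by congr (_ * expR _ + _)%:E; field.
Qed.
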